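(* Let $B=(X,Y,E)$ be a finite bipartite graph with parts $X$ and $Y$. Then the following are equivalent: (a) $B$ is a signed-interval bigraph; (b) $B$ has Ferrers dimension at most $2$.
   Context: A signed interval is a pair $I_v=[l(v),r(v)]$ of real numbers; it is positive (written $I_v^+$) if $l(v)\le r(v)$ and negative (written $I_v^-$) if $l(v)>r(v)$. For a positive $I_u^+$ and positive $I_v^+$, $I_u^+\cap I_v^+\neq\emptyset$ has the usual meaning (equivalently $l(u)\le r(v)$ and $l(v)\le r(u)$). For a negative $I_v^-$ and a positive $I_u^+$, $I_v^-\subseteq I_u^+$ means $l(u)\le r(v)$ and $l(v)\le r(u)$, i.e. the real interval $[r(v),l(v)]$ is contained in $[l(u),r(u)]$. A bipartite graph $B=(X,Y,E)$ is a signed-interval bigraph if one can assign to each vertex $v\in X\cup Y$ a signed interval $I_v$ (positive or negative) such that for $x\in X$, $y\in Y$: $xy\in E$ if and only if ($I_x^+\cap I_y^+\neq\emptyset$ with both positive) or ($I_x^-\subseteq I_y^+$) or ($I_y^-\subseteq I_x^+$). A Ferrers bigraph is a bipartite graph $(X,Y,F)$ in which the neighbourhoods of the vertices of $X$ are linearly ordered by inclusion (equivalently, its biadjacency matrix contains no $2\times 2$ permutation submatrix). The Ferrers dimension of $B=(X,Y,E)$ is the minimum number $k$ of Ferrers bigraphs $(X,Y,F_1),\dots,(X,Y,F_k)$ with $E=F_1\cap\dots\cap F_k$. Equivalently, $B$ has Ferrers dimension at most $2$ iff the rows and columns of its biadjacency matrix can be permuted independently so that no $0$ entry has a $1$ both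 below it (in its column) and to its right (in its row). *)

(* Defs.v *)
From HB Require Import structures.
From mathcomp Require Import classical_sets set_interval reals.
From mathcomp Require Import all_boot all_order all_algebra.

Set Implicit Arguments.
Unset Strict Implicit.
Unset Printing Implicit Defensive.

Import Order.TTheory GRing.Theory Num.Theory.

(** A bipartite graph with finite parts [X] and [Y] is given by its edge set
    [E : {set X * Y}]. *)

Section SignedIntervals.
Variable R : realType.
Local Open Scope ring_scope.

(** The pair [(l, r)]; no order between [l] and [r] is assumed. *)
Definition signed_interval : Type := (R * R)%type.

Definition left_end (I : signed_interval) : R := I.1.
Definition right_end (I : signed_interval) : R := I.2.

Definition si_positive (I : signed_interval) : Prop :=
  left_end I <= right_end I.

Definition si_negative (I : signed_interval) : Prop :=
  right_end I < left_end I.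

Definition pos_pos_meet (I J : signed_interval) : Prop :=
  [/\ si_positive I, si_positive J
    & (`[left_end I, right_end I]%classic `&` `[left_end J, right_end J]%classic
       !=set0)%classic].

(** [I] negative, [J] positive, and the real interval [[r(I), l(I)]] is
    contained in [[l(J), r(J)]]. *)
Definition neg_sub_pos (I J : signed_interval) : Prop :=
  [/\ si_negative I, si_positive J,
      left_end J <= right_end I & left_end I <= right_end J].

Definition signed_interval_bigraph (X Y : finType) (E : {set X * Y}) : Prop :=
  exists (I : X -> signed_interval) (J : Y -> signed_interval),
    forall (x : X) (y : Y),
      (x, y) \in E <->
      [\/ pos_pos_meet (I x) (J y),
          neg_sub_pos (I x) (J y)
        | neg_sub_pos (J y) (I x)].

End SignedIntervals.

Section FerrersDimension.
Variables X Y : finType.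
Implicit Types E F : {set X * Y}.

Definition neighbours F (x : X) : {set Y} := [set y | (x, y) \in F].

Definition ferrers F : bool :=
  [forall x1 : X, forall x2 : X,
     (neighbours F x1 \subset neighbours F x2)
  || (neighbours F x2 \subset neighbours F x1)].

(** An intersection of [k] Ferrers bigraphs is taken with [k >= 1], so that the
    complete bigraph has dimension 1 rather than 0. *)
Definition ferrers_realizable E (k : nat) : bool :=
  (0 < k) &&
  [exists F : {ffun 'I_k -> {set X * Y}},
     [forall i, ferrers (F i)] && (E == \bigcap_(i < k) F i)].

(** [E] is the intersection of the Ferrers bigraphs obtained by deleting a
    single non-edge from the complete bigraph. *)
Lemma ferrers_realizable_ex E : exists k, ferrers_realizable E k.
Proof.
pose s := [seq ~: [set p] | p <- enum (~: E)].
exists (size s).+1; apply/andP; split=> //.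
apply/existsP; exists [ffun i : 'I_(size s).+1 => nth setT s i].
apply/andP; split.
  apply/forallP => i; rewrite ffunE; apply/forallP => x1; apply/forallP => x2.
  have [ge_si|lt_is] := leqP (size s) i.
    rewrite nth_default //; apply/orP; left.
    by apply/subsetP => y; rewrite !inE.
  have /mapP [[a b] _ ->] := mem_nth setT lt_is.
  have [eq_xa|neq_xa] := eqVneq x1 a; apply/orP; [left|right];
    apply/subsetP => y; rewrite !inE !xpair_eqE.
    by rewrite eq_xa eqxx /= => /negPf ->; rewrite andbF.
  by rewrite (negPf neq_xa).
apply/eqP/setP => p; apply/idP/bigcapP => [pE i _|allp].
  rewrite ffunE; have [ge_si|lt_is] := leqP (size s) i.
    by rewrite nth_default // inE.
  have /mapP [q + ->] := mem_nth setT lt_is.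
  rewrite mem_enum !inE => qNE.
  by apply: contraNneq qNE => <-.
apply/negPn/negP => pNE.
have sp : ~: [set p] \in s.
  by apply/mapP; exists p => //; rewrite mem_enum inE.
have lt_ps : index (~: [set p]) s < (size s).+1.
  by rewrite ltnW // ltnS index_mem.
have := allp (Ordinal lt_ps) isT.
by rewrite ffunE /= nth_index // !inE eqxx.
Qed.

Definition ferrers_dim E : nat := ex_minn (ferrers_realizable_ex E).

End FerrersDimension.

(* Main.v *)
Require Import Defs.
From mathcomp Require Import classical_sets set_interval reals.
From mathcomp Require Import all_boot all_order all_algebra.

(** A vertex pair is an edge of a signed-interval bigraph iff
    [l(x) <= r(y)] and [l(y) <= r(x)]: two negative intervals never satisfy both
    inequalities. Each inequality on its own is a threshold bigraph
    [f x <= g y], and threshold bigraphs are exactly the Ferrers bigraphs. *)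

Set Implicit Arguments.
Unset Strict Implicit.
Unset Printing Implicit Defensive.

Import Order.TTheory GRing.Theory Num.Theory.

Section FerrersThreshold.
Variables X Y : finType.
Implicit Types E F : {set X * Y}.

Lemma ferrers_threshold d (T : orderType d) (f : X -> T) (g : Y -> T) :
  ferrers [set p | (f p.1 <= g p.2)%O].
Proof.
apply/forallP => x1; apply/forallP => x2.
case/orP: (le_total (f x1) (f x2)) => le_f; apply/orP; [right|left];
  by apply/subsetP => y; rewrite !inE; apply: le_trans.
Qed.

(** With the empty maximum equal to 0, a vertex of [Y] adjacent to all of [X] gets
    level 0. *)
Definition ferrers_level F (y : Y) : nat :=
  \max_(x | (x, y) \notin F) #|neighbours F x|.+1.

(** If [(x, y)] is a non-edge, [x] itself contributes to the maximum, so the level exceeds its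
    degree. If it is an edge and [x'] misses [y], then comparability forces the neighbourhood of
    [x'] to be a proper subset of that of [x], hence strictly smaller. *)
Lemma ferrers_levelP F x y :
  ferrers F -> ((x, y) \in F) = (ferrers_level F y <= #|neighbours F x|).
Proof.
move=> ferF; apply/idP/idP => [xyF|]; last first.
  by apply: contraLR => xyNF; rewrite -ltnNge; apply: leq_bigmax_cond.
apply/bigmax_leqP => x' x'yNF; apply: proper_card; rewrite properE.
have yNsub : ~~ (neighbours F x \subset neighbours F x').
  by apply/subsetPn; exists y; rewrite inE.
by case/orP: (forallP (forallP ferF x) x') yNsub => [->|->].
Qed.

Lemma ferrers_dim_le2P E :
  ferrers_dim E <= 2 <->
  exists F G : {set X * Y}, [/\ ferrers F, ferrers G & E = F :&: G].
Proof.
rewrite /ferrers_dim; case: ex_minnP => k realk mink; split=> [le_k2|].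
  case/andP: realk => k_gt0 /existsP[H /andP[/forallP ferH /eqP ->]].
  case: k k_gt0 le_k2 H ferH {mink} => [|[|[|//]]] // _ _ H ferH.
    (* For [k = 1] the only bigraph is taken twice. *)
    by exists (H ord0), (H ord0); rewrite big_ord1 setIid.
  by exists (H ord0), (H ord_max); rewrite big_ord_recl big_ord1;
    split=> //; congr (_ :&: H _); apply: val_inj.
case=> F [G [ferF ferG defE]]; apply: mink; apply/andP; split=> //.
apply/existsP; exists [ffun i : 'I_2 => if i == ord0 then F else G].
apply/andP; split; first by apply/forallP => i; rewrite ffunE; case: ifP.
by rewrite big_ord_recl big_ord1 !ffunE /= defE.
Qed.

End FerrersThreshold.

Section SignedIntervalEdges.
Variable R : realType.
Local Open Scope ring_scope.

Lemma signed_interval_edgeP (I J : signed_interval R) :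
  [\/ pos_pos_meet I J, neg_sub_pos I J | neg_sub_pos J I] <->
  (left_end I <= right_end J) && (left_end J <= right_end I).
Proof.
case: I J => [a b] [c d].
rewrite /pos_pos_meet /neg_sub_pos /si_positive /si_negative /left_end /right_end /=.
split=> [[[_ _ [z []]]|[_ _ -> ->]|[_ _ -> ->]] //|/andP[le_ad le_cb]].
  rewrite /= !in_itv /= => /andP[le_az le_zb] /andP[le_cz le_zd].
  by rewrite (le_trans le_az le_zd) (le_trans le_cz le_zb).
have [le_ab|lt_ba] := leP a b; have [le_cd|lt_dc] := leP c d.
(* The larger left end is a common point of two positive intervals. *)
- apply: Or31; split=> //; exists (Num.max a c).
  by split; rewrite /= in_itv /= le_max ge_max ?lexx ?orbT /= ?le_ab ?le_ad.
- by apply: Or33.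
- by apply: Or32.
(* Two negative intervals would give [a <= d < c <= b < a]. *)
have := le_lt_trans le_ad (lt_le_trans lt_dc le_cb).
by rewrite ltNge (ltW lt_ba).
Qed.

End SignedIntervalEdges.

Theorem theorem8 (R : realType) (X Y : finType) (E : {set X * Y}) :
  signed_interval_bigraph R E <-> ferrers_dim E <= 2.
Proof.
split=> [[I [J edgeE]]|/ferrers_dim_le2P[F [G [ferF ferG ->]]]].
  apply/ferrers_dim_le2P.
  exists [set p | (left_end (I p.1) <= right_end (J p.2))%O].
  (* Negation puts the vertex of [X] on the smaller side, as a threshold bigraph requires. *)
  exists [set p | (- right_end (I p.1) <= - left_end (J p.2))%R].
  split.
  - exact: (ferrers_threshold (fun x => left_end (I x))
                              (fun y => right_end (J y))).
  - exact: (ferrers_threshold (fun x => - right_end (I x))%R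
                              (fun y => - left_end (J y))%R).
  - apply/setP => -[x y]; rewrite !inE /= lerN2.
    by apply/idP/idP => [/edgeE|] /signed_interval_edgeP // /edgeE.
(* [F] is encoded by [l(x) <= r(y)] and [G] by [l(y) <= r(x)]. The degree of [x] is the upper bound
   in [ferrers_levelP], so the values for [F] are negated to reverse that inequality. *)
exists (fun x => (- #|neighbours F x|%:R, #|neighbours G x|%:R)%R).
exists (fun y => ((ferrers_level G y)%:R, - (ferrers_level F y)%:R)%R).
move=> x y.
apply: iff_trans (iff_sym (signed_interval_edgeP _ _)).
by rewrite /left_end /right_end /= lerN2 !ler_nat inE !ferrers_levelP.
Qed.
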